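(* For all $s,t\in\mathbb{N}_0=\{0,1,2,\dots\}$ and all $a\in\left(0,\tfrac12\right)$, $$\nu_{st}\left(a,\tfrac12-a\right)=\lim_{\theta\to0+}\nu_{st}\left(a\sqrt{1-\theta},\left(\tfrac12-a\right)\sqrt{1-\theta}\right).$$
   Context: For $s,t\in\mathbb{N}_0$ and real $a,b>0$ with $a+b\le\tfrac12$, the lag $(s,t)$ variogram is $$\nu_{st}(a,b):=\frac{1}{\pi^2}\int_0^\pi\int_0^\pi\frac{1-\cos(sx)\cos(ty)}{1-2a\cos x-2b\cos y}\,\mathrm{d}x\,\mathrm{d}y .$$ When $a+b=\tfrac12$ the denominator vanishes only at $(x,y)=(0,0)$, and the integral is understood as a Lebesgue integral. *)

(* Defs.v *)
From mathcomp Require Import all_boot all_order all_algebra.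
From mathcomp Require Import all_classical all_reals all_analysis.

Set Implicit Arguments.
Unset Strict Implicit.
Unset Printing Implicit Defensive.

Import Order.TTheory GRing.Theory Num.Theory.
Import numFieldNormedType.Exports.

Local Open Scope classical_set_scope.
Local Open Scope ring_scope.

(* At a zero of the denominator the quotient takes the library's value [z / 0 = 0].
   For [0 < a], [0 < b], [a + b <= 1/2] the only such point in [0, pi]^2 is the
   origin (when [a + b = 1/2]), a null set, so this does not affect [variogram]. *)
Definition variogram_integrand (R : realType) (s t : nat) (a b : R)
    (p : R * R) : R :=
  (1 - cos (s%:R * p.1) * cos (t%:R * p.2)) /
  (1 - 2 * a * cos p.1 - 2 * b * cos p.2).

Definition halfperiod_square (R : realType) : set (R * R) :=
  `[0, pi] `*` `[0, pi].

(* The integral is kept extended-real valued, so that an infinite integral is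
   not silently replaced by a real number. *)
Definition variogram (R : realType) (s t : nat) (a b : R) : \bar R :=
  (((pi ^+ 2)^-1)%:E *
   \int[lebesgue_measure \x lebesgue_measure]_(p in @halfperiod_square R)
     (variogram_integrand s t a b p)%:E)%E.

(* Main.v *)
(* Put [b = 1/2 - a] and [G = a (1 - cos x) + b (1 - cos y)]. From
   [|sin (n x)| <= n |sin x|] one gets [1 - cos (n x) <= n^2 (1 - cos x)], so
   the numerator is at most [(s^2 / a + t^2 / b) G]. The denominator at
   [(a c, b c)] is at least [G] for all [0 <= c <= 1]. Hence the integrands are
   uniformly bounded, the singularity at the origin included, and dominated
   convergence on the finite-measure square applies with a constant bound. *)
Require Import Defs.
From mathcomp Require Import all_boot all_order all_algebra.
From mathcomp Require Import all_classical all_reals all_analysis.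
From mathcomp Require Import measurable_realfun ring lra.

Import Order.TTheory GRing.Theory Num.Theory.
Import numFieldNormedType.Exports.

Local Open Scope classical_set_scope.
Local Open Scope ring_scope.

Lemma normr_sin_mulrn_le {R : realType} (n : nat) (x : R) :
  `|sin (n%:R * x)| <= n%:R * `|sin x|.
Proof.
elim: n => [|n IHn]; first by rewrite !mul0r sin0 normr0.
rewrite -natr1 !mulrDl !mul1r sinD (le_trans (ler_normD _ _))// !normrM lerD//.
  by rewrite (le_trans _ IHn)// -[leRHS]mulr1 ler_wpM2l// cos_max.
by rewrite -[leRHS]mul1r ler_wpM2r// cos_max.
Qed.

Lemma onem_cosE {R : realType} (x : R) : 1 - cos x = 2 * sin (x / 2) ^+ 2.
Proof.
have {1}-> : x = x / 2 + x / 2 by lra.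
by have := cos2Dsin2 (x / 2); rewrite cosD; lra.
Qed.

Lemma onem_cos_mulrn_le {R : realType} (n : nat) (x : R) :
  1 - cos (n%:R * x) <= n%:R ^+ 2 * (1 - cos x).
Proof.
rewrite !onem_cosE [leRHS]mulrCA ler_wpM2l// -mulrA -exprMn.
rewrite -[leLHS]real_normK ?num_real// -[leRHS]real_normK ?num_real//.
by rewrite normrM normr_nat lerXn2r ?nnegrE ?mulr_ge0// normr_sin_mulrn_le.
Qed.

Lemma onem_cosM_ge0 {R : realType} (x y : R) : 0 <= 1 - cos x * cos y.
Proof.
rewrite subr_ge0 (le_trans (ler_norm _))// normrM.
by rewrite mulr_ile1// cos_max.
Qed.

Lemma onem_cosM_le {R : realType} (s t : nat) (a b x y : R) :
    0 < a -> 0 < b ->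
  1 - cos (s%:R * x) * cos (t%:R * y) <=
  (s%:R ^+ 2 / a + t%:R ^+ 2 / b) * (a * (1 - cos x) + b * (1 - cos y)).
Proof.
move=> a0 b0.
have X0 : 0 <= 1 - cos x by rewrite subr_ge0 cos_le1.
have Y0 : 0 <= 1 - cos y by rewrite subr_ge0 cos_le1.
apply: (@le_trans _ _ ((1 - cos (s%:R * x)) + (1 - cos (t%:R * y)))).
  rewrite -subr_ge0.
  have -> : 1 - cos (s%:R * x) + (1 - cos (t%:R * y)) -
      (1 - cos (s%:R * x) * cos (t%:R * y)) =
      (1 - cos (s%:R * x)) * (1 - cos (t%:R * y)) by ring.
  by rewrite mulr_ge0// subr_ge0 cos_le1.
apply: (@le_trans _ _ (s%:R ^+ 2 * (1 - cos x) + t%:R ^+ 2 * (1 - cos y))).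
  by rewrite lerD// onem_cos_mulrn_le.
rewrite -subr_ge0.
have -> : (s%:R ^+ 2 / a + t%:R ^+ 2 / b) * (a * (1 - cos x) + b * (1 - cos y))
    - (s%:R ^+ 2 * (1 - cos x) + t%:R ^+ 2 * (1 - cos y)) =
    s%:R ^+ 2 / a * b * (1 - cos y) + t%:R ^+ 2 / b * a * (1 - cos x).
  by field; rewrite !gt_eqF.
by rewrite addr_ge0// !mulr_ge0// ?invr_ge0 ?sqr_ge0// ltW.
Qed.

(* The right-hand side is affine in [c], equal to [1] at [c = 0] and to twice
   the left-hand side at [c = 1]. *)
Lemma variogram_denom_ge {R : realType} (a b c x y : R) :
    0 < a -> 0 < b -> a + b = 2^-1 -> 0 <= c <= 1 ->
  a * (1 - cos x) + b * (1 - cos y) <=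
  1 - 2 * (a * c) * cos x - 2 * (b * c) * cos y.
Proof.
move=> a0 b0 ab /andP[c0 c1].
have bE : b = 2^-1 - a by lra.
have X0 : 0 <= 1 + cos x by rewrite -lerBlDl sub0r cos_geN1.
have Y0 : 0 <= 1 + cos y by rewrite -lerBlDl sub0r cos_geN1.
have X1 : 0 <= 1 - cos x by rewrite subr_ge0 cos_le1.
have Y1 : 0 <= 1 - cos y by rewrite subr_ge0 cos_le1.
rewrite -subr_ge0.
have -> : 1 - 2 * (a * c) * cos x - 2 * (b * c) * cos y -
    (a * (1 - cos x) + b * (1 - cos y)) =
    (1 - c) * (a * (1 + cos x) + b * (1 + cos y)) +
    c * (a * (1 - cos x) + b * (1 - cos y)).
  by rewrite bE; field.
by rewrite addr_ge0// mulr_ge0// ?subr_ge0// addr_ge0// mulr_ge0// ltW.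
Qed.

Lemma variogram_integrand_le {R : realType} (s t : nat) (a b c : R)
    (p : R * R) : 0 < a -> 0 < b -> a + b = 2^-1 -> 0 <= c <= 1 ->
  `|variogram_integrand s t (a * c) (b * c) p| <=
  s%:R ^+ 2 / a + t%:R ^+ 2 / b.
Proof.
move=> a0 b0 ab c01; rewrite /variogram_integrand.
have := variogram_denom_ge a b c p.1 p.2 a0 b0 ab c01.
have := onem_cosM_le s t a b p.1 p.2 a0 b0.
set N := 1 - cos _ * _; set D := 1 - _ - _; set G := a * _ + _; set K := _ + _.
move=> NK GD.
have K0 : 0 <= K by rewrite addr_ge0// divr_ge0 ?sqr_ge0// ltW.
have N0 : 0 <= N by exact: onem_cosM_ge0.
have G0 : 0 <= G by rewrite addr_ge0// mulr_ge0// ?subr_ge0 ?cos_le1// ltW.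
have := le_trans G0 GD; rewrite le_eqVlt => /predU1P[<-|D0].
  by rewrite invr0 mulr0 normr0.
rewrite ger0_norm ?divr_ge0 ?(ltW D0)// ler_pdivrMr//.
by rewrite (le_trans NK)// ler_wpM2l.
Qed.

Lemma cvg_variogram_integrand {R : realType} (s t : nat) (a b : R)
    (p : R * R) (u : R^nat) : 0 < a -> 0 < b -> a + b = 2^-1 ->
    u n @[n --> \oo] --> (1 : R) ->
  variogram_integrand s t (a * u n) (b * u n) p @[n --> \oo] -->
  variogram_integrand s t a b p.
Proof.
move=> a0 b0 ab u1; rewrite /variogram_integrand.
have ku k : k * u n @[n --> \oo] --> k.
  by rewrite -[X in _ --> X]mulr1; apply: cvgM => //; exact: cvg_cst.
have [D0|D0] := eqVneq (1 - 2 * a * cos p.1 - 2 * b * cos p.2) 0.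
  suff -> : 1 - cos (s%:R * p.1) * cos (t%:R * p.2) = 0.
    by under eq_fun do rewrite mul0r; rewrite mul0r; exact: cvg_cst.
  apply/eqP; rewrite eq_le onem_cosM_ge0 andbT.
  rewrite (le_trans (onem_cosM_le s t a b p.1 p.2 a0 b0))//.
  suff -> : a * (1 - cos p.1) + b * (1 - cos p.2) = 0 by rewrite mulr0.
  apply: (mulfI (x := 2)) => //; rewrite mulr0 -[RHS]D0.
  by rewrite (_ : b = 2^-1 - a); [field|lra].
apply: cvgM; first exact: cvg_cst.
apply: cvgV => //; apply: cvgB; [apply: cvgB; first exact: cvg_cst|];
  by apply: cvgM; [apply: cvgM => //|]; exact: cvg_cst.
Qed.

Lemma measurable_invr {R : realType} :
  measurable_fun [set: R] (GRing.inv : R -> R).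
Proof.
rewrite -(setUv [set 0]); apply/measurable_funU => //.
  exact: measurableC.
split; first exact: measurable_fun_set1.
apply: open_continuous_measurable_fun.
  by apply: closed_openC; exact: closed_eq.
by move=> x; rewrite inE/= => /eqP x0; exact: inv_continuous.
Qed.

Lemma measurable_cos {R : realType} : measurable_fun [set: R] (@cos R).
Proof. exact: continuous_measurable_fun (@continuous_cos R). Qed.

Lemma measurable_variogram_integrand {R : realType} (s t : nat) (a b : R)
    (D : set (R * R)) : measurable_fun D (variogram_integrand s t a b).
Proof.
apply: measurable_funTS; rewrite /variogram_integrand.
have mc k : measurable_fun [set: R * R] (fun p : R * R => cos (k * p.1)).
  apply: measurableT_comp (@measurable_cos R) _.
  by apply: measurable_funM => //; exact: measurable_fst.
have mc' k : measurable_fun [set: R * R] (fun p : R * R => cos (k * p.2)).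
  apply: measurableT_comp (@measurable_cos R) _.
  by apply: measurable_funM => //; exact: measurable_snd.
apply: measurable_funM.
  by apply: measurable_funB => //; apply: measurable_funM.
apply: measurableT_comp (@measurable_invr R) _.
by repeat (apply: measurable_funB || apply: measurable_funM) => //;
  apply: measurableT_comp (@measurable_cos R) _.
Qed.

Lemma measurable_halfperiod_square {R : realType} :
  measurable (@halfperiod_square R).
Proof. by apply: measurableX; exact: measurable_itv. Qed.

Lemma halfperiod_square_lty (R : realType) :
  ((lebesgue_measure \x lebesgue_measure) (@halfperiod_square R) < +oo)%E.
Proof.
have fin : (lebesgue_measure `[0%R, pi : R] < +oo)%E.
  by rewrite lebesgue_measure_itv/=; case: ifP => _; rewrite ?ltry.
rewrite product_measure1E; try exact: measurable_itv.
by apply: lte_mul_pinfty; rewrite ?ge0_fin_numE.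
Qed.

Lemma integrable_cst_halfperiod_square {R : realType} (k : R) :
  (lebesgue_measure \x lebesgue_measure)%E.-integrable (@halfperiod_square R)
    (EFin \o cst k).
Proof.
apply: measurable_bounded_integrable.
- exact: measurable_halfperiod_square.
- exact: halfperiod_square_lty.
- exact: measurable_cst.
- by exists `|k|; split; [exact: num_real|move=> M kM x _; exact: ltW].
Qed.

Lemma integrable_variogram_integrand {R : realType} (s t : nat) (a b c : R) :
    0 < a -> 0 < b -> a + b = 2^-1 -> 0 <= c <= 1 ->
  (lebesgue_measure \x lebesgue_measure)%E.-integrable (@halfperiod_square R)
    (EFin \o variogram_integrand s t (a * c) (b * c)).
Proof.
move=> a0 b0 ab c01.
apply: le_integrable (integrable_cst_halfperiod_square
  (s%:R ^+ 2 / a + t%:R ^+ 2 / b)).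
- exact: measurable_halfperiod_square.
- by apply/measurable_EFinP; exact: measurable_variogram_integrand.
- move=> p _; rewrite /= lee_fin.
  apply: le_trans (variogram_integrand_le _ _ _ _ _ _ a0 b0 ab c01) _.
  exact: ler_norm.
Qed.

Lemma variogram_fin_num {R : realType} (s t : nat) (a b c : R) :
    0 < a -> 0 < b -> a + b = 2^-1 -> 0 <= c <= 1 ->
  variogram s t (a * c) (b * c) \is a fin_num.
Proof.
move=> a0 b0 ab c01; rewrite fin_numM// integrable_fin_num//.
  exact: measurable_halfperiod_square.
exact: integrable_variogram_integrand.
Qed.

Lemma cvg_variogram {R : realType} (s t : nat) (a b : R) (u : R^nat) :
    0 < a -> 0 < b -> a + b = 2^-1 -> (forall n, 0 <= u n <= 1) ->
    u n @[n --> \oo] --> (1 : R) ->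
  variogram s t (a * u n) (b * u n) @[n --> \oo] --> variogram s t a b.
Proof.
move=> a0 b0 ab u01 u1; apply: cvgeZl => //.
pose g : R * R -> \bar R := EFin \o cst (s%:R ^+ 2 / a + t%:R ^+ 2 / b).
apply: (@dominated_cvg _ _ _ (lebesgue_measure \x lebesgue_measure)%E _
  measurable_halfperiod_square
  (fun n => EFin \o variogram_integrand s t (a * u n) (b * u n)) _ g) => //.
- by move=> n; apply/measurable_EFinP; exact: measurable_variogram_integrand.
- by move=> p _; apply: cvg_EFin; [exact: nearW|exact: cvg_variogram_integrand].
- exact: integrable_cst_halfperiod_square.
- by move=> n p _; rewrite lee_fin variogram_integrand_le.
Qed.

Theorem theorem2 (R : realType) (s t : nat) (a : R) (ha : 0 < a < 2^-1) :
  variogram s t a (2^-1 - a) \is a fin_num /\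
  variogram s t (a * Num.sqrt (1 - theta)) ((2^-1 - a) * Num.sqrt (1 - theta))
    @[theta --> 0^'+] --> variogram s t a (2^-1 - a).
Proof.
have [a0 b0] : 0 < a /\ 0 < 2^-1 - a by lra.
have ab : a + (2^-1 - a) = 2^-1 by lra.
have sqrt01 (theta : R) : 0 < theta -> 0 <= Num.sqrt (1 - theta) <= 1.
  move=> theta0; rewrite sqrtr_ge0/= -[leRHS]sqrtr1 ler_sqrt//.
  by rewrite gerBl ltW.
have fin : variogram s t a (2^-1 - a) \is a fin_num.
  have := variogram_fin_num s t a (2^-1 - a) 1 a0 b0 ab.
  by rewrite !mulr1; apply; rewrite ler01 lexx.
split=> //; rewrite -(fineK fin); apply/fine_cvgP; split.
  near=> theta; apply: variogram_fin_num => //; apply: sqrt01.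
  by near: theta; exact: nbhs_right_gt.
apply/cvg_at_rightP => u [u0 ucvg].
apply: fine_cvg; rewrite fineK//.
apply: (cvg_variogram s t a (2^-1 - a) (fun n => Num.sqrt (1 - u n))) => //.
  by move=> n; exact: sqrt01.
rewrite -[X in _ --> X]sqrtr1.
apply: continuous_cvg; first exact: sqrt_continuous.
rewrite -[X in _ --> X]subr0; apply: cvgB => //; exact: cvg_cst.
Unshelve. all: by end_near. Qed.
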